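(* Let $H$ be a group, let $T$ be an $H$-tree with trivial edge stabilisers, and let $\mathcal{T}$ be an $H$-tree obtained from $T$ by collapsing an $H$-subforest of $T$. For a vertex $v$ of $\mathcal{T}$ let $H_v$ be its stabiliser in $H$. Then, as elements of $\mathbb{N}\cup\{\infty\}$, $$\kappa_T(H)=\sum_{vH\in V\mathcal{T}/H}\kappa_T(H_v)+\mathrm{rank}(\mathcal{T}/H),$$ where the sum is over representatives $v$ of the $H$-orbits of vertices of $\mathcal{T}$. In particular, the left hand side is infinite if and only if the right hand side is infinite.
   Context: Groups act on trees on the right, by graph automorphisms and without edge inversions. An $H$-tree is a (nonempty) tree with such an action of $H$; $VT$ and $ET$ denote its vertex and edge sets. An $H$-subforest of $T$ is an $H$-invariant subgraph of $T$; collapsing it means collapsing each of its connected components to a single vertex, the resulting graph $\mathcal{T}$ being a tree with induced $H$-action. For a connected graph $\Gamma$, $\mathrm{rank}(\Gamma)\in\mathbb{N}\cup\{\infty\}$ is the number of edges outside a maximal subtree (equivalently the rank of the free group $\pi_1(\Gamma)$). Kurosh rank: for a tree $T$ on which a group acts with trivial edge stabilisers and a subgroup $L$ of that group, let $c_T(L)\in\mathbb{N}\cup\{\infty\}$ be the number of $L$-orbits $vL\in VT/L$ of vertices $v$ whose $L$-stabiliser is non-trivial; then $\kappa_T(L)=c_T(L)+\mathrm{rank}(T/L)$. *)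

(* Defs.v *)
From HB Require Import structures.
From mathcomp Require Import all_boot.
From mathcomp Require Import finmap boolp classical_sets functions cardinality.
From mathcomp Require Import fsbigop constructive_ereal.

Set Implicit Arguments.
Unset Strict Implicit.
Unset Printing Implicit Defensive.

Local Open Scope quotient_scope.
Local Open Scope group_scope.
Local Open Scope classical_set_scope.

(* [\bar nat] stands for N u {oo}: its value [-oo] is never produced below. *)

Definition ecard (I : choiceType) (A : set I) : \bar nat :=
  if `[< finite_set A >] then (#|` fset_set A |)%:E else +oo%E.

Definition nsum (I : choiceType) (f : I -> \bar nat) : \bar nat :=
  let supp := [set i | f i != 0%E] in
  if `[< finite_set supp >] then (\sum_(i <- fset_set supp) f i)%E else +oo%E.

(* Graphs in the sense of Serre: multigraphs, possibly infinite and with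
   loops, in which every geometric edge is a pair {e, erev e} of oppositely
   oriented edges. *)
Record graph := Graph {
  vertex : choiceType;
  edge : choiceType;
  src : edge -> vertex;
  erev : edge -> edge;
  erevK : involutive erev;
  erev_neq : forall e, erev e != e }.

Definition tgt (G : graph) (e : edge G) : vertex G := src (erev e).

Fixpoint walk (G : graph) (x : vertex G) (p : seq (edge G)) (y : vertex G) :
    Prop :=
  if p is e :: p' then src e = x /\ walk (tgt e) p' y else x = y.

Definition reduced (G : graph) (p : seq (edge G)) : bool :=
  sorted (fun e f => f != erev e) p.

Record subgraph (G : graph) := Subgraph {
  sverts : set (vertex G);
  sedges : set (edge G);
  sedges_erev : forall e, sedges e -> sedges (erev e);
  sedges_src : forall e, sedges e -> sverts (src e) }.

Definition full_subgraph (G : graph) : subgraph G :=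
  @Subgraph G setT setT (fun _ _ => I) (fun _ _ => I).

Definition subgraph_le (G : graph) (S S' : subgraph G) : Prop :=
  sverts S `<=` sverts S' /\ sedges S `<=` sedges S'.

Definition walk_in (G : graph) (S : subgraph G)
    (x : vertex G) (p : seq (edge G)) (y : vertex G) : Prop :=
  walk x p y /\ (forall e, e \in p -> sedges S e).

Lemma walk_in_cat (G : graph) (S : subgraph G) x y z p q :
  walk_in S x p y -> walk_in S y q z -> walk_in S x (p ++ q) z.
Proof.
move=> [xpy pS] [yqz qS]; split; last first.
  by move=> e; rewrite mem_cat => /orP[/pS|/qS].
by elim: p x xpy {pS} => [x -> //|e p IHp x /= [-> /IHp]].
Qed.

Lemma walk_in_rev (G : graph) (S : subgraph G) x y p :
  walk_in S x p y -> walk_in S y (rev (map (@erev G) p)) x.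
Proof.
elim: p x => [x [<- _]|e p IHp x [/= [<- epy] pS]]; first by split.
rewrite rev_cons -cats1; apply: (@walk_in_cat _ _ _ (tgt e)).
  by apply: IHp; split=> // f fp; apply: pS; rewrite inE fp orbT.
split=> /= [|f]; first by rewrite /tgt erevK.
by rewrite inE => /eqP ->; apply/sedges_erev/pS; rewrite inE eqxx.
Qed.

Definition is_subtree (G : graph) (S : subgraph G) : Prop :=
  [/\ sverts S !=set0,
      forall x y, sverts S x -> sverts S y -> exists p, walk_in S x p y
    & forall x p, walk_in S x p x -> reduced p -> p = [::]].

Definition is_tree (G : graph) : Prop := is_subtree (full_subgraph G).

Definition maximal_subtree (G : graph) (M : subgraph G) : Prop :=
  is_subtree M /\
  forall S, is_subtree S -> subgraph_le M S -> subgraph_le S M.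

Definition geometric_edges (G : graph) (A : set (edge G)) :
    set (set (edge G)) :=
  [set [set e; erev e] | e in A].

(* Only meaningful for connected graphs, where a maximal subtree exists and the
   number does not depend on it. *)
Definition rank (G : graph) : \bar nat :=
  xget +oo%E [set n | exists2 M : subgraph G, maximal_subtree M
                      & n = ecard (geometric_edges (~` sedges M))].

(* A graph with a right action of [H] without edge inversions. *)
Record hgraph (H : groupType) := HGraph {
  hgraph_graph :> graph;
  actv : vertex hgraph_graph -> H -> vertex hgraph_graph;
  acte : edge hgraph_graph -> H -> edge hgraph_graph;
  actv1 : forall v, actv v 1 = v;
  actvM : forall v g h, actv v (g * h) = actv (actv v g) h;
  acte1 : forall e, acte e 1 = e;
  acteM : forall e g h, acte e (g * h) = acte (acte e g) h;
  src_acte : forall e h, src (acte e h) = actv (src e) h;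
  erev_acte : forall e h, erev (acte e h) = acte (erev e) h;
  no_inversion : forall e h, acte e h != erev e }.

Section Action.
Variables (H : groupType) (X : hgraph H).

Definition trivial_edge_stabilisers : Prop :=
  forall (e : edge X) (h : H), acte e h = e -> h = 1.

Definition invariant_subgraph (F : subgraph X) : Prop :=
  (forall v h, sverts F v -> sverts F (actv v h)) /\
  (forall e h, sedges F e -> sedges F (acte e h)).

Definition stab (v : vertex X) : {pred H} := fun h => actv v h == v.

Lemma actvK v h : actv (actv v h) h^-1 = v :> vertex X.
Proof. by rewrite -actvM mulgV actv1. Qed.

Lemma acteK e h : acte (acte e h) h^-1 = e :> edge X.
Proof. by rewrite -acteM mulgV acte1. Qed.

Lemma stab_mulg v : mulg_closed (stab v).
Proof.
move=> g h; rewrite !unfold_in => /eqP gv /eqP hv.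
by rewrite /stab actvM gv hv.
Qed.

Lemma stab_1 v : 1 \in stab v.
Proof. by rewrite unfold_in /stab actv1. Qed.

Lemma stab_invg v : invg_closed (stab v).
Proof.
by move=> h; rewrite !unfold_in /stab => /eqP hv; rewrite -{1}hv actvK.
Qed.

Lemma walk_in_act (F : subgraph X) (F_inv : invariant_subgraph F) x y p h :
  walk_in F x p y ->
  walk_in F (actv x h) (map (fun e => acte e h) p) (actv y h).
Proof.
move=> [xpy pF]; split; last first.
  by move=> _ /mapP[e ep ->]; apply/F_inv.2/pF.
elim: p x xpy {pF} => [x -> //|e p IHp x /= [<- /IHp]].
by rewrite /tgt erev_acte !src_acte.
Qed.

End Action.

HB.instance Definition _ H (X : hgraph H) v :=
  isMulClosed.Build H (stab v) (@stab_mulg H X v).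
HB.instance Definition _ H (X : hgraph H) v :=
  isMul1Closed.Build H (stab v) (@stab_1 H X v).
HB.instance Definition _ H (X : hgraph H) v :=
  isInvClosed.Build H (stab v) (@stab_invg H X v).

Definition whole (H : groupType) : {pred H} := fun=> true.
Arguments whole : clear implicits.

Fact whole_mulg (H : groupType) : mulg_closed (whole H). Proof. by []. Qed.
Fact whole_1 (H : groupType) : 1 \in whole H. Proof. by []. Qed.
Fact whole_invg (H : groupType) : invg_closed (whole H). Proof. by []. Qed.

HB.instance Definition _ (H : groupType) :=
  isMulClosed.Build H (whole H) (@whole_mulg H).
HB.instance Definition _ (H : groupType) :=
  isMul1Closed.Build H (whole H) (@whole_1 H).
HB.instance Definition _ (H : groupType) :=
  isInvClosed.Build H (whole H) (@whole_invg H).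

Section Quotient.
Variables (H : groupType) (X : hgraph H) (L : groupClosed H).

Definition orbv (x y : vertex X) : bool :=
  `[< exists2 h, h \in L & actv x h = y >].

Definition orbe (x y : edge X) : bool :=
  `[< exists2 h, h \in L & acte x h = y >].

Fact orbv_refl : reflexive orbv.
Proof. by move=> x; apply/asboolP; exists 1; rewrite ?gpred1 ?actv1. Qed.

Fact orbv_sym : symmetric orbv.
Proof.
suff s x y : orbv x y -> orbv y x by move=> x y; apply/idP/idP; exact: s.
move=> /asboolP[h hL <-]; apply/asboolP; exists h^-1; rewrite ?gpredV //.
exact: actvK.
Qed.

Fact orbv_trans : transitive orbv.
Proof.
move=> y x z /asboolP[g gL <-] /asboolP[h hL <-]; apply/asboolP.
by exists (g * h); rewrite ?gpredM ?actvM.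
Qed.

Fact orbe_refl : reflexive orbe.
Proof. by move=> x; apply/asboolP; exists 1; rewrite ?gpred1 ?acte1. Qed.

Fact orbe_sym : symmetric orbe.
Proof.
suff s x y : orbe x y -> orbe y x by move=> x y; apply/idP/idP; exact: s.
move=> /asboolP[h hL <-]; apply/asboolP; exists h^-1; rewrite ?gpredV //.
exact: acteK.
Qed.

Fact orbe_trans : transitive orbe.
Proof.
move=> y x z /asboolP[g gL <-] /asboolP[h hL <-]; apply/asboolP.
by exists (g * h); rewrite ?gpredM ?acteM.
Qed.

Canonical orbv_equiv := EquivRel orbv orbv_refl orbv_sym orbv_trans.
Canonical orbe_equiv := EquivRel orbe orbe_refl orbe_sym orbe_trans.

Definition vorbit : choiceType := {eq_quot orbv_equiv}.
Definition eorbit : choiceType := {eq_quot orbe_equiv}.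

Definition vclass (x : vertex X) : vorbit := \pi_({eq_quot orbv_equiv}) x.
Definition eclass (e : edge X) : eorbit := \pi_({eq_quot orbe_equiv}) e.

Definition quot_src (o : eorbit) : vorbit :=
  vclass (src (repr (o : {eq_quot orbe_equiv}))).
Definition quot_rev (o : eorbit) : eorbit :=
  eclass (erev (repr (o : {eq_quot orbe_equiv}))).

Lemma vclassP x y :
  vclass x = vclass y <-> exists2 h, h \in L & actv x h = y.
Proof.
by split=> [/eqmodP/asboolP|xy] //; apply/eqmodP/asboolP.
Qed.

Lemma eclassP x y :
  eclass x = eclass y <-> exists2 h, h \in L & acte x h = y.
Proof.
by split=> [/eqmodP/asboolP|xy] //; apply/eqmodP/asboolP.
Qed.

Lemma eclassW (o : eorbit) : exists e, o = eclass e.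
Proof. by exists (repr (o : {eq_quot orbe_equiv})); rewrite /eclass reprK. Qed.

Lemma quot_srcE e : quot_src (eclass e) = vclass (src e).
Proof.
apply/vclassP; set e' := repr _.
have /eclassP[h hL <-] : eclass e' = eclass e by rewrite /eclass reprK.
by exists h => //; rewrite src_acte.
Qed.

Lemma quot_revE e : quot_rev (eclass e) = eclass (erev e).
Proof.
apply/eclassP; set e' := repr _.
have /eclassP[h hL <-] : eclass e' = eclass e by rewrite /eclass reprK.
by exists h => //; rewrite erev_acte.
Qed.

Fact quot_revK : involutive quot_rev.
Proof. by move=> o; have [e ->] := eclassW o; rewrite !quot_revE erevK. Qed.

Fact quot_rev_neq o : quot_rev o != o.
Proof.
have [e ->] := eclassW o; rewrite quot_revE; apply/eqP => /esym/eclassP[h _].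
exact/eqP/no_inversion.
Qed.

Definition quot : graph := @Graph vorbit eorbit quot_src quot_rev
  quot_revK quot_rev_neq.

Definition kurosh_c : \bar nat :=
  ecard [set o : vertex quot | exists v : vertex X,
    o = vclass v /\ exists h, [/\ h \in L, h != 1 & actv v h = v]].

Definition kappa : \bar nat := (kurosh_c + rank quot)%E.

End Quotient.

(* Only the edges of [F] matter for the collapse: a vertex that is isolated in
   [F], or that does not lie in [F], is not identified with any other vertex. *)
Section Collapse.
Variables (H : groupType) (X : hgraph H) (F : subgraph X).
Variable F_inv : invariant_subgraph F.

Definition conn (x y : vertex X) : bool :=
  `[< exists p, walk_in F x p y >].

Fact conn_refl : reflexive conn.
Proof. by move=> x; apply/asboolP; exists [::]. Qed.

Fact conn_sym : symmetric conn.
Proof.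
suff s x y : conn x y -> conn y x by move=> x y; apply/idP/idP; exact: s.
move=> /asboolP[p xpy]; apply/asboolP.
exists (rev (map (@erev X) p)); exact: walk_in_rev.
Qed.

Fact conn_trans : transitive conn.
Proof.
move=> y x z /asboolP[p xpy] /asboolP[q yqz]; apply/asboolP.
by exists (p ++ q); exact: walk_in_cat xpy yqz.
Qed.

Canonical conn_equiv := EquivRel conn conn_refl conn_sym conn_trans.

Definition cvertex : choiceType := {eq_quot conn_equiv}.

Definition cedge : choiceType := {e : edge X | `[< ~ sedges F e >]}.

Definition component (x : vertex X) : cvertex := \pi_({eq_quot conn_equiv}) x.

Lemma componentP x y :
  component x = component y <-> exists p, walk_in F x p y.
Proof. by split=> [/eqmodP/asboolP|xy] //; apply/eqmodP/asboolP. Qed.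

Lemma componentW (c : cvertex) : exists v, c = component v.
Proof.
by exists (repr (c : {eq_quot conn_equiv})); rewrite /component reprK.
Qed.

Fact erev_out e : `[< ~ sedges F e >] -> `[< ~ sedges F (erev e) >].
Proof.
move=> /asboolP eF; apply/asboolP => /(@sedges_erev X F).
by rewrite erevK.
Qed.

Fact acte_out (e : edge X) h :
  `[< ~ sedges F e >] -> `[< ~ sedges F (acte e h) >].
Proof.
move=> /asboolP eF; apply/asboolP => /(F_inv.2 _ h^-1).
by rewrite acteK.
Qed.

Definition collapse_src (e : cedge) : cvertex := component (src (val e)).
Definition collapse_rev (e : cedge) : cedge :=
  exist _ (erev (val e)) (erev_out (valP e)).

Fact collapse_revK : involutive collapse_rev.
Proof. by move=> e; apply: val_inj; rewrite /= erevK. Qed.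

Fact collapse_rev_neq e : collapse_rev e != e.
Proof. by rewrite -val_eqE /= erev_neq. Qed.

Definition collapse_graph : graph := @Graph cvertex cedge
  collapse_src collapse_rev collapse_revK collapse_rev_neq.

Definition collapse_actv (c : cvertex) (h : H) : cvertex :=
  component (actv (repr (c : {eq_quot conn_equiv})) h).
Definition collapse_acte (e : cedge) (h : H) : cedge :=
  exist _ (acte (val e) h) (acte_out h (valP e)).

Lemma collapse_actvE v h :
  collapse_actv (component v) h = component (actv v h).
Proof.
apply/componentP; set v' := repr _.
have /componentP[p vpv'] : component v' = component v.
  by rewrite /component reprK.
by exists (map (fun e => acte e h) p); exact: walk_in_act.
Qed.

Fact collapse_actv1 c : collapse_actv c 1 = c.
Proof. by have [v ->] := componentW c; rewrite collapse_actvE actv1. Qed.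

Fact collapse_actvM c g h :
  collapse_actv c (g * h) = collapse_actv (collapse_actv c g) h.
Proof. by have [v ->] := componentW c; rewrite !collapse_actvE actvM. Qed.

Fact collapse_acte1 e : collapse_acte e 1 = e.
Proof. by apply: val_inj; rewrite /= acte1. Qed.

Fact collapse_acteM e g h :
  collapse_acte e (g * h) = collapse_acte (collapse_acte e g) h.
Proof. by apply: val_inj; rewrite /= acteM. Qed.

Fact collapse_src_acte (e : edge collapse_graph) h :
  src (collapse_acte e h : edge collapse_graph) = collapse_actv (src e) h.
Proof. by rewrite /src /= /collapse_src /= collapse_actvE src_acte. Qed.

Fact collapse_rev_acte (e : edge collapse_graph) h :
  erev (collapse_acte e h : edge collapse_graph) = collapse_acte (erev e) h.
Proof. by apply: val_inj; rewrite /= erev_acte. Qed.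

Fact collapse_no_inversion (e : edge collapse_graph) h :
  (collapse_acte e h : edge collapse_graph) != erev e.
Proof. by rewrite -val_eqE /= no_inversion. Qed.

Definition collapse : hgraph H := @HGraph H collapse_graph
  collapse_actv collapse_acte collapse_actv1 collapse_actvM
  collapse_acte1 collapse_acteM collapse_src_acte collapse_rev_acte
  collapse_no_inversion.

End Collapse.

(* Main.v *)
Require Import Defs.
From mathcomp Require Import all_boot ssralg.
From mathcomp Require Import finmap boolp classical_sets functions cardinality.
From mathcomp Require Import constructive_ereal.

(* The rank of a connected graph is the number of edges outside any spanning
   tree, by exchange along cuts.  Choose a spanning tree [S] of [T / H] that
   also spans every component of [F / H]; then [S] minus [F / H] is a spanning
   tree of the quotient of the collapsed tree.  For a component [T_c] of [F]
   with stabiliser [L], every vertex outside [T_c] has a unique edge towards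
   [T_c].  Hence no nontrivial element of [L] fixes a vertex outside [T_c], and
   all edges of [T / L] outside [T_c / L] are bridges, so these edges together
   with those of [T_c / L] lying over [S] form a spanning tree of [T / L].
   Counting orbits and edges outside the trees, component by component, gives
   the formula. *)

Set Implicit Arguments.
Unset Strict Implicit.
Unset Printing Implicit Defensive.

Import GRing.Theory.
Local Open Scope classical_set_scope.

(** * Cardinals *)

Section Ecard.
Implicit Types I J : choiceType.

Lemma ecard_fin I (A : set I) :
  finite_set A -> ecard A = (#|` fset_set A|)%:E.
Proof. by move=> Afin; rewrite /ecard asboolT. Qed.

Lemma ecard_inf I (A : set I) : infinite_set A -> ecard A = +oo%E.
Proof. by move=> Ainf; rewrite /ecard asboolF. Qed.

Lemma ecard0 I : ecard (set0 : set I) = 0%E.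
Proof. by rewrite ecard_fin// fset_set0 cardfs0. Qed.

Lemma ecard1 I (x : I) : ecard [set x] = 1%E.
Proof. by rewrite ecard_fin// fset_set1 cardfs1. Qed.

Lemma ecard_eq0 I (A : set I) : (ecard A == 0%E) = (A == set0).
Proof.
apply/eqP/eqP => [|->]; last exact: ecard0.
case: (pselect (finite_set A)) => [Afin|Ainf]; last by rewrite ecard_inf.
rewrite ecard_fin// => -[/eqP]; rewrite cardfs_eq0 => /eqP.
exact: fset_set_set0.
Qed.

Lemma ecard_image I J (f : I -> J) (A : set I) :
  {in A &, injective f} -> ecard (f @` A) = ecard A.
Proof.
move=> finj; case: (pselect (finite_set A)) => [Afin|Ainf].
  rewrite !ecard_fin//; last exact: finite_image.
  rewrite fset_set_image// card_in_imfset//= => x y.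
  by rewrite !in_fset_set//; exact: finj.
by rewrite !ecard_inf//; rewrite (eq_finite_set (inj_card_eq finj)).
Qed.

Lemma ecardU I (A B : set I) :
  A `&` B = set0 -> ecard (A `|` B) = (ecard A + ecard B)%E.
Proof.
move=> AB0; case: (pselect (finite_set A)) => [Afin|Ainf]; last first.
  rewrite (ecard_inf Ainf) ecard_inf.
    by rewrite /ecard; case: ifP.
  by rewrite finite_setU => -[].
case: (pselect (finite_set B)) => [Bfin|Binf]; last first.
  rewrite (ecard_inf Binf) ecard_inf.
    by rewrite /ecard; case: ifP.
  by rewrite finite_setU => -[].
rewrite !ecard_fin//; last by rewrite finite_setU.
rewrite fset_setU// cardfsU -fset_setI// AB0 fset_set0 cardfs0 subn0.
by [].
Qed.

(** If infinitely many [A j] are nonempty, one chosen point in each embeds the support in the union,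
    so both sides are infinite. Otherwise [ecardU] is iterated over the support. *)
Lemma ecard_bigcup I J (A : J -> set I) :
  trivIset setT A -> ecard (\bigcup_j A j) = nsum (fun j => ecard (A j)).
Proof.
move=> tA; rewrite /nsum; set supp := [set j | _].
have suppE j : supp j <-> A j !=set0.
  by rewrite /supp /= ecard_eq0; split=> /set0P.
case: asboolP => [sfin|sinf]; last first.
  rewrite ecard_inf// => Ufin; apply: sinf.
  case: (pselect (exists i0 : I, True)) => [[i0 _]|nI]; last first.
    suff -> : supp = set0 by exact: finite_set0.
    by rewrite -subset0 => j /suppE[i _]; apply: nI; exists i.
  pose g j := xget i0 (A j).
  have gP j : supp j -> A j (g j) by move=> /suppE[i]; exact: xgetI.
  have ginj : {in supp &, injective g}.
    move=> j k /set_mem/gP gj /set_mem/gP gk gjk; apply: tA => //.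
    by exists (g j); split=> //; rewrite gjk.
  rewrite -(eq_finite_set (inj_card_eq ginj)).
  by apply: sub_finite_set Ufin => _ [j /gP gj <-]; exists j.
have -> : \bigcup_j A j = \big[setU/set0]_(j <- fset_set supp) A j.
  rewrite bigsetU_fset_set//; apply/seteqP; split=> i [j jP Aji];
    exists j => //.
  by apply/suppE; exists i.
have := fset_uniq (fset_set supp).
elim: {sfin}(enum_fset _) => [|j s IHs] /=; first by rewrite !big_nil ecard0.
move=> /andP[js us]; rewrite !big_cons ecardU ?IHs//.
rewrite -subset0 => i [Aji]; rewrite -bigcup_seq => -[k /= ks Aki].
suff jk : j = k by rewrite jk ks in js.
by apply: tA => //; exists i.
Qed.

(** Each sum of two cardinals is the cardinal of a subset of [I1 + I2], which reduces the claim to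
    [ecard_bigcup] for one disjoint family. *)
Lemma nsum_ecardD I1 I2 J (A : J -> set I1) (B : J -> set I2) :
  trivIset setT A -> trivIset setT B ->
  nsum (fun j => ecard (A j) + ecard (B j))%E =
  (ecard (\bigcup_j A j) + ecard (\bigcup_j B j))%E.
Proof.
move=> tA tB.
have sumE (C : set I1) (D : set I2) :
    (ecard C + ecard D)%E = ecard ((inl : _ -> I1 + I2)%type @` C `|` inr @` D).
  rewrite ecardU ?ecard_image//.
  - by move=> x y _ _ [].
  - by move=> x y _ _ [].
  - by rewrite -subset0 => _ [[x _ <-] [y _ //]].
rewrite sumE; under eq_fun do rewrite sumE.
rewrite -ecard_bigcup; last first.
  move=> j k _ _ [_ [] [[x Ax <-]|[x Ax <-]] [] [y Ay //]] [xy].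
    by apply: tA => //; exists x; split=> //; rewrite -xy.
  by apply: tB => //; exists x; split=> //; rewrite -xy.
congr ecard; apply/seteqP; split=> [u [j _ [] [x Ax <-]]|u [] [x [j _ Ax] <-]].
- by left; exists x => //; exists j.
- by right; exists x => //; exists j.
- by exists j => //; left; exists x.
- by exists j => //; right; exists x.
Qed.

End Ecard.

(** * Spanning trees and rank *)

Section SpanningTree.
Variable G : graph.
Implicit Types (x y z : vertex G) (e f : edge G) (p q : seq (edge G)).
Implicit Types (A B C S : set (edge G)).

Definition symmetric_edges A := forall e, A e -> A (erev e).

(* Existence of a walk in [A], stated through cuts: non-linked vertices are
   separated by a set of vertices that [A] does not leave. *)
Definition linked A x y := forall P : set (vertex G),
  (forall e, A e -> P (src e) -> P (tgt e)) -> P x -> P y.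

(** Every edge of [A] is a bridge; [acyclicP] identifies this with the absence of nonempty reduced
    closed walks. *)
Definition acyclic A :=
  forall e, A e -> ~ linked (A `\` [set e; erev e]) (src e) (tgt e).

Definition spanning_tree A :=
  [/\ symmetric_edges A, forall x y, linked A x y & acyclic A].

Lemma tgt_erev e : tgt (erev e) = src e. Proof. by rewrite /tgt erevK. Qed.

Lemma sym_pair e : symmetric_edges [set e; erev e].
Proof. by move=> f [->|->]; [right|left; rewrite erevK]. Qed.

Lemma sym_setC A : symmetric_edges A -> symmetric_edges (~` A).
Proof. by move=> sA e nAe /sA; rewrite erevK. Qed.

Lemma sym_setI A B :
  symmetric_edges A -> symmetric_edges B -> symmetric_edges (A `&` B).
Proof. by move=> sA sB e [/sA ? /sB]. Qed.

Lemma sym_setU A B :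
  symmetric_edges A -> symmetric_edges B -> symmetric_edges (A `|` B).
Proof. by move=> sA sB e [/sA|/sB]; [left|right]. Qed.

Lemma sym_setD A B :
  symmetric_edges A -> symmetric_edges B -> symmetric_edges (A `\` B).
Proof. by move=> sA sB; apply: sym_setI => //; exact: sym_setC. Qed.

Lemma linked_refl A x : linked A x x. Proof. by []. Qed.
#[local] Hint Resolve linked_refl : core.

Lemma linked_trans A y x z : linked A x y -> linked A y z -> linked A x z.
Proof. by move=> xy yz P PA /(xy P PA); exact: yz. Qed.

Lemma linked_edge A e : A e -> linked A (src e) (tgt e).
Proof. by move=> Ae P; exact. Qed.

Lemma linked_sub A B x y :
  (forall e, A e -> linked B (src e) (tgt e)) -> linked A x y -> linked B x y.
Proof.
move=> AB xy P PB; apply: xy => e /AB; exact.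
Qed.

Lemma linkedS A B x y : A `<=` B -> linked A x y -> linked B x y.
Proof. by move=> AB; apply: linked_sub => e /AB; exact: linked_edge. Qed.

Lemma linked_sym A x y : symmetric_edges A -> linked A x y -> linked A y x.
Proof.
move=> sA xy; apply: (xy (fun z => linked A z x)) => // e Ae /(linked_trans _).
by apply; have := linked_edge (sA _ Ae); rewrite tgt_erev.
Qed.

(** A link may be taken to cross [e] at most once, in one of two directions. The disjunction itself,
    as a predicate of the endpoint, is stable along all edges. *)
Lemma linkedU1 A e x y : linked (A `|` [set e; erev e]) x y ->
  [\/ linked A x y, linked A x (src e) /\ linked A (tgt e) y
    | linked A x (tgt e) /\ linked A (src e) y].
Proof.
move=> xy; apply: (xy (fun z => [\/ linked A x z,
  linked A x (src e) /\ linked A (tgt e) z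
  | linked A x (tgt e) /\ linked A (src e) z])); last by apply: Or31.
move=> f [Af|[->|->]].
- have ff := linked_edge Af.
  case=> [xf|[xe ef]|[xe ef]]; [apply: Or31|apply: Or32|apply: Or33].
  + exact: linked_trans ff.
  + by split=> //; exact: linked_trans ff.
  + by split=> //; exact: linked_trans ff.
- by move=> [xf|[xe ef]|[xe ef]]; [apply: Or32|apply: Or32|apply: Or31].
- rewrite tgt_erev.
  by move=> [xf|[xe ef]|[xe ef]]; [apply: Or33|apply: Or31|apply: Or33].
Qed.

Lemma acyclicS A B : A `<=` B -> acyclic B -> acyclic A.
Proof.
move=> AB aB e Ae /linkedS ee; apply: (aB e (AB _ Ae)); apply: ee.
exact: setSD.
Qed.

(** If some [f] in [A] stopped being a bridge, the link replacing it would cross [e]; following its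
    two remaining pieces together with [f] would link the ends of [e] inside [A]. *)
Lemma acyclicU1 A e : symmetric_edges A -> acyclic A ->
  ~ linked A (src e) (tgt e) -> acyclic (A `|` [set e; erev e]).
Proof.
move=> sA aA ne f; case: (pselect ([set e; erev e] f)) => [ef _|nef].
  have sub : (A `|` [set e; erev e]) `\` [set f; erev f] `<=` A.
    move=> g [[//|eg] []].
    by case: ef eg => -> [->|->]; rewrite ?erevK; [left|right|right|left].
  move=> /(linkedS sub) ff; case: ef ff => ->; first exact: ne.
  by rewrite tgt_erev => /(linked_sym sA); exact: ne.
case=> // Af ff; pose B := A `\` [set f; erev f].
have BA : B `<=` A by move=> ? [].
have sB : symmetric_edges B by apply: sym_setD => //; exact: sym_pair.
have {}ff : linked (B `|` [set e; erev e]) (src f) (tgt f).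
  by apply: linkedS ff => g [[Ag|eg] fg]; [left|right].
have fA : linked A (tgt f) (src f) := linked_sym sA (linked_edge Af).
case/linkedU1: ff => [/(aA _ Af)//|[fe ef]|[fe ef]]; apply: ne.
- apply: linked_trans (linkedS BA (linked_sym sB fe)) _.
  apply: linked_trans (linked_sym sA fA) _.
  exact: linkedS BA (linked_sym sB ef).
- apply: linked_trans (linkedS BA ef) _; apply: linked_trans fA _.
  exact: linkedS BA fe.
Qed.

(** Zorn's lemma extends [B] to a spanning forest of [C]: an edge of [C] with unlinked ends could
    still be added by [acyclicU1]. *)
Lemma maximal_acyclic B C :
  symmetric_edges B -> symmetric_edges C -> acyclic B -> B `<=` C ->
  exists A, [/\ symmetric_edges A, acyclic A, B `<=` A, A `<=` C
    & forall e, C e -> linked A (src e) (tgt e)].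
Proof.
move=> sB sC aB BC.
pose P A := [/\ A `<=` C, symmetric_edges A & acyclic (B `|` A)].
have [F FP totF|A [[AC sA aBA] Amax]] := @Zorn_bigcup _ P.
  split=> [e [A /FP[AC _ _] /AC]//|e [A FA Ae]|].
    by exists A => //; have [_ sA _] := FP _ FA; exact: sA.
  (* Adjoining the empty set keeps the chain total and makes it nonempty, so that edges of [B] also
     belong to some [B]|[A]. *)
  pose F' A := A = set0 \/ F A.
  have F'P A : F' A -> P A.
    by case=> [->|/FP//]; split=> //; rewrite setU0.
  have F'tot A A' : F' A -> F' A' -> exists2 D, F' D & A `|` A' `<=` D.
    move=> [->|FA] [->|FA'].
    - by exists set0; [left|rewrite setU0].
    - by exists A'; [right|rewrite set0U].
    - by exists A; [right|rewrite setU0].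
    - have [AA'|A'A] := totF _ _ FA FA'; [exists A'|exists A]; try by right.
        by move=> g [/AA'|].
      by move=> g [|/A'A].
  move=> e Be ee.
  have [A FA BAe] : exists2 A, F' A & (B `|` A) e.
    by case: Be => [Be|[A FA Ae]]; [exists set0; left|exists A; right].
  (* A link in the union of the chain already lives in one member, which is enlarged as each new
     edge of the link is met. *)
  have [D FD De] : exists2 D, F' D &
      linked ((B `|` D) `\` [set e; erev e]) (src e) (tgt e).
    apply: (ee (fun z => exists2 D, F' D &
      linked ((B `|` D) `\` [set e; erev e]) (src e) z)); last first.
      by exists set0; [left|].
    move=> f [Bf ef] [D FD Df].
    have [D' FD' BDf] : exists2 D, F' D & (B `|` D) f.
      by case: Bf => [Bf|[D' FD' D'f]]; [exists set0; left|exists D'; right].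
    have [E FE sE] := F'tot _ _ FD FD'; exists E => //.
    apply: (@linked_trans _ (src f)).
      by apply: linkedS Df; apply: setSD; apply: setUS => g Dg; apply: sE; left.
    apply: linked_edge; split=> //; case: BDf => [|D'f]; first by left.
    by right; apply: sE; right.
  have [E FE sE] := F'tot _ _ FD FA.
  have [_ _ /(_ e) aE] := F'P _ FE; apply: aE.
    by case: BAe => [|Ae]; [left|right; apply: sE; right].
  by apply: linkedS De; apply: setSD; apply: setUS => g Dg; apply: sE; left.
have sBA := sym_setU sB sA.
exists (B `|` A); split=> //.
  by move=> e [/BC|/AC].
move=> e Ce; apply: contrapT => ne.
apply: (Amax (A `|` [set e; erev e])).
  split; first by move=> f; left.
  move=> /(_ e) eA; apply: ne; apply: linked_edge; right; apply: eA.
  by right; left.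
split; last by rewrite setUA; exact: acyclicU1.
  by move=> f [/AC//|[->//|->]]; exact: sC.
by apply: sym_setU => //; exact: sym_pair.
Qed.

Definition walk_on A x p y := walk x p y /\ (forall e, e \in p -> A e).

Lemma walk_cat x y p q :
  walk x (p ++ q) y <-> exists2 z, walk x p z & walk z q y.
Proof.
elim: p x => [|e p IHp] x /=; first by split=> [xy|[z ->]//]; exists x.
split=> [[-> /IHp[z ez zy]]|[z [-> ez zy]]]; first by exists z.
by split=> //; apply/IHp; exists z.
Qed.

Lemma linkedP A x y : linked A x y <-> exists p, walk_on A x p y.
Proof.
split=> [xy|[p [xpy pA]]].
  apply: (xy (fun z => exists p, walk_on A x p z)); last by exists [::].
  move=> e Ae [p [xp pA]].
  exists (rcons p e); split=> [|f].
    by rewrite -cats1; apply/walk_cat; exists (src e).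
  by rewrite mem_rcons inE => /orP[/eqP->|/pA].
elim: p x xpy pA => [x -> //|e p IHp x [<- epy] pA].
apply: (@linked_trans _ (tgt e)).
  exact: linked_edge (pA _ (mem_head _ _)).
by apply: IHp => // f fp; apply: pA; rewrite inE fp orbT.
Qed.

Lemma reduced_walk A x p y :
  walk_on A x p y -> exists2 q, walk_on A x q y & reduced q.
Proof.
elim: p x => [x xy|e p IHp x [/= [<- epy] pA]]; first by exists [::].
have [|q [eqy qA] rq] := IHp (tgt e).
  by split=> // f fp; apply: pA; rewrite inE fp orbT.
have Ae : A e by apply: pA; rewrite inE eqxx.
case: q => [|f q] in eqy qA rq *.
  by exists [:: e] => //; split=> // f; rewrite inE => /eqP ->.
have [fe|fe] := eqVneq f (erev e).
  exists q; last by move: rq => /path_sorted.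
  move: eqy => /= [_]; rewrite fe tgt_erev => qy; split=> // g gq.
  by apply: qA; rewrite inE gq orbT.
exists [:: e, f & q]; last by rewrite /reduced /= fe.
split=> // g; rewrite inE => /orP[/eqP ->//|]; exact: qA.
Qed.

(** A reduced walk joining the ends of [e] without [e] closes up with [e] to a reduced loop.
    Conversely, induct on the length of a loop with first edge [e]: a second [e] cuts off a shorter
    loop; a later [erev e] encloses a shorter loop, hence an empty one, and the walk backtracks;
    otherwise the rest of the loop shows that [e] is not a bridge. *)
Lemma acyclicP A : symmetric_edges A ->
  (forall x p, walk_on A x p x -> reduced p -> p = [::]) <-> acyclic A.
Proof.
move=> sA; have sD e : symmetric_edges (A `\` [set e; erev e]).
  by apply: sym_setD => //; exact: sym_pair.
split=> [noloop e Ae /(linked_sym (sD e)) /linkedP[p]|aA x p].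
  move=> /reduced_walk[q [eqe qA] rq].
  suff : e :: q = [::] by [].
  apply: (noloop (src e)).
    by split=> // f; rewrite inE => /orP[/eqP ->//|/qA[]].
  case: q => [//|f q] in eqe qA rq *; rewrite /reduced /= in rq *.
  rewrite rq andbT; apply/eqP => fe.
  by have [_ []] := qA f (mem_head _ _); right.
have [n] := ubnP (size p); elim: n => // n IHn in x p *.
case: p => [//|e q] /ltnSE qn [[<- eqe] qA] rq.
have {}eqe : walk (tgt e) q (src e) := eqe.
have Ae : A e by apply: qA; rewrite inE eqxx.
case: (boolP (e \in q)) => [/splitPr qE|eq].
  case: qE => q1 q2 in qn eqe qA rq *.
  suff : e :: q1 = [::] by [].
  apply: (IHn (src e)) => //.
  - by apply: leq_trans qn; rewrite /= size_cat /= addnS !ltnS leq_addr.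
  - split; last first.
      move=> f f1; apply: qA; rewrite -cat_cons mem_cat f1 //.
    by move: eqe => /walk_cat[z ez [zE _]]; split=> //; rewrite zE.
  - by move: rq; rewrite /reduced -cat_cons => /cat_sorted2[].
case: (boolP (erev e \in q)) => [/splitPr qE|req].
  case: qE => q1 q2 in qn eqe qA rq {eq} *.
  suff q10 : q1 = [::] by move: rq; rewrite q10 /reduced /= eqxx.
  apply: (IHn (tgt e)) => //.
  - by apply: leq_trans qn; rewrite /= size_cat ltnS leq_addr.
  - split; last by move=> f f1; apply: qA; rewrite inE mem_cat f1 orbT.
    by move: eqe => /walk_cat[z ez [zE _]]; rewrite {2}/tgt zE.
  - by move: rq => /path_sorted/cat_sorted2[].
case: (aA e Ae); apply: linked_sym => //; apply/linkedP; exists q; split=> //.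
move=> f fq; split; first by apply: qA; rewrite inE fq orbT.
by case=> fE; [move: eq|move: req]; rewrite -fE fq.
Qed.

Lemma is_subtreeE (M : subgraph G) :
  is_subtree M <-> [/\ sverts M !=set0,
    forall x y, sverts M x -> sverts M y -> linked (sedges M) x y
    & acyclic (sedges M)].
Proof.
have sM : symmetric_edges (sedges M) := @sedges_erev _ M.
have aP := acyclicP sM.
split=> -[M0 Mconn Mtree]; split=> //; [|exact/aP| |exact/aP] => x y Mx My.
  exact/linkedP/Mconn.
by have /linkedP := Mconn _ _ Mx My.
Qed.

(** An edge leaving [M] could be added together with its target, giving a larger subtree. So no edge
    leaves [M], and connectedness puts every vertex in it. *)
Lemma maximal_subtree_spanning (M : subgraph G) :
  (forall x y, linked setT x y) -> maximal_subtree M ->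
  sverts M = setT /\ spanning_tree (sedges M).
Proof.
move=> Gconn [/is_subtreeE[[x0 Mx0] Mconn Mtree] Mmax].
have sM : symmetric_edges (sedges M) := @sedges_erev _ M.
suff MT : sverts M = setT.
  by split=> //; split=> // x y; apply: Mconn; rewrite MT.
rewrite -subTset => y _; apply: (Gconn x0 y (sverts M)) => // e _ Me.
apply: contrapT => nMe.
have M'e : symmetric_edges (sedges M `|` [set e; erev e]).
  by apply: sym_setU => //; exact: sym_pair.
have M's f : (sedges M `|` [set e; erev e]) f ->
    (sverts M `|` [set tgt e]) (src f).
  by case=> [/sedges_src|[->|->]]; [left|left|right].
have ne : ~ linked (sedges M) (src e) (tgt e).
  move=> /(_ (sverts M)) ee; apply: nMe; apply: ee => // f Mf _.
  exact/sedges_src/sM.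
have [||+ _] := Mmax (Subgraph M'e M's); last first.
- by move=> /(_ (tgt e)) ee; apply: nMe; apply: ee; right.
- by split=> z; left.
apply/is_subtreeE; split=> /=; last exact: acyclicU1.
  by exists x0; left.
have ML := @linkedS _ (sedges M `|` [set e; erev e]) _ _ (@subsetUl _ _ _).
have Le : linked (sedges M `|` [set e; erev e]) (src e) (tgt e).
  by apply: linked_edge; right; left.
move=> x z [Mx|->] [Mz|->].
- by apply: ML; exact: Mconn.
- exact: linked_trans (ML _ _ (Mconn _ _ Mx Me)) Le.
- apply: linked_sym => //.
  exact: linked_trans (ML _ _ (Mconn _ _ Mz Me)) Le.
- by [].
Qed.

End SpanningTree.

#[local] Hint Resolve linked_refl : core.

(** * Counting unoriented edges *)

Section GeometricEdges.
Implicit Types G : graph.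

Lemma geometric_edges_set1 G (e : edge G) :
  geometric_edges [set e; erev e] = [set [set e; erev e]].
Proof.
apply/seteqP; split=> [_ [f [->|->] <-]//|_ ->]; last first.
  by exists e => //; left.
by rewrite erevK setUC.
Qed.

Lemma geometric_edgesU G (A B : set (edge G)) :
  geometric_edges (A `|` B) = geometric_edges A `|` geometric_edges B.
Proof. exact: image_setU. Qed.

Lemma geometric_edgesI0 G (A B : set (edge G)) : symmetric_edges B ->
  A `&` B = set0 -> geometric_edges A `&` geometric_edges B = set0.
Proof.
move=> sB /disjoints_subset AB; rewrite -subset0 => _ [[e Ae <-] [f Bf fe]].
have : [set f; erev f] e by rewrite fe; left.
by case=> eE; apply: (AB _ Ae); rewrite eE //; exact: sB.
Qed.

Lemma ecard_geometric_edgesU G (A B : set (edge G)) :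
  symmetric_edges B -> A `&` B = set0 ->
  ecard (geometric_edges (A `|` B)) =
  (ecard (geometric_edges A) + ecard (geometric_edges B))%E.
Proof.
by move=> sB AB; rewrite geometric_edgesU ecardU//; exact: geometric_edgesI0.
Qed.

Lemma ecard_geometric_edgesD1 G (A : set (edge G)) e :
  symmetric_edges A -> A e -> ecard (geometric_edges A) =
  (ecard (geometric_edges (A `\` [set e; erev e])) + 1)%E.
Proof.
move=> sA Ae; rewrite -{1}(@setDKU _ [set e; erev e] A).
  rewrite ecard_geometric_edgesU ?geometric_edges_set1 ?ecard1//.
    exact: sym_pair.
  exact: setDKI.
by move=> f [->|->] //; exact: sA.
Qed.

Lemma geometric_edges_image G G' (phi : edge G -> edge G') (A : set (edge G)) :
  (forall e, A e -> phi (erev e) = erev (phi e)) ->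
  geometric_edges (phi @` A) = image^~ phi @` geometric_edges A.
Proof.
move=> phiN; apply/seteqP; split=> [_ [_ [e Ae <-] <-]|_ [_ [e Ae <-] <-]].
  exists [set e; erev e]; first by exists e.
  by rewrite image_setU !image_set1 phiN.
exists (phi e); first by exists e.
by rewrite image_setU !image_set1 phiN.
Qed.

Lemma ecard_geometric_edges_image G G' (phi : edge G -> edge G')
    (A : set (edge G)) : symmetric_edges A ->
  (forall e, A e -> phi (erev e) = erev (phi e)) -> {in A &, injective phi} ->
  ecard (geometric_edges (phi @` A)) = ecard (geometric_edges A).
Proof.
move=> sA phiN inj; rewrite geometric_edges_image// ecard_image//.
have sub X : geometric_edges A X -> X `<=` A.
  by move=> [e Ae <-] f [->|->] //; exact: sA.
have half X Y : geometric_edges A X -> geometric_edges A Y ->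
    phi @` X = phi @` Y -> X `<=` Y.
  move=> /sub XA /sub YA XY e Xe; have : (phi @` Y) (phi e).
    by rewrite -XY; exists e.
  move=> [f Yf /inj <-] //; apply/mem_set; [exact: YA|exact: XA].
move=> X Y /set_mem AX /set_mem AY XY; apply/seteqP; split; exact: half.
Qed.

End GeometricEdges.

(** * Independence of the rank from the spanning tree *)

Section Rank.
Variable G : graph.
Implicit Types S : set (edge G).

Lemma spanning_tree_subset S S' :
  spanning_tree S -> spanning_tree S' -> S' `<=` S -> S' = S.
Proof.
move=> [_ _ aS] [sS' cS' _] S'S; apply/seteqP; split=> // e Se.
apply: contrapT => nS'e; apply: (aS e Se); apply: linkedS (cS' _ _) => f S'f.
split; first exact: S'S.
by case=> fE; apply: nS'e; [rewrite -fE|rewrite -(erevK e) -fE; exact: sS'].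
Qed.

(* The exchange [f] crosses the cut that removing [e] from [S'] creates. *)
Lemma spanning_tree_exchange S S' e :
    spanning_tree S -> spanning_tree S' -> S' e -> ~ S e ->
  exists f, [/\ S f, ~ S' f
    & spanning_tree ((S' `\` [set e; erev e]) `|` [set f; erev f])].
Proof.
move=> [sS cS _] [sS' cS' aS'] S'e nSe; pose D := S' `\` [set e; erev e].
have sD : symmetric_edges D by apply: sym_setD => //; exact: sym_pair.
have aD : acyclic D by apply: acyclicS aS' => ? [].
have [f [Sf ef nef]] : exists f, [/\ S f, linked D (src e) (src f)
    & ~ linked D (src e) (tgt f)].
  apply: contrapT => nf; apply: (aS' e S'e).
  apply: (cS (src e) (tgt e) (linked D (src e))) => // f Sf ef.
  by apply: contrapT => nef; apply: nf; exists f.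
have nff : ~ linked D (src f) (tgt f).
  by move=> ff; apply: nef; exact: linked_trans ff.
have nS'f : ~ S' f.
  move=> S'f; apply: nff; apply: linked_edge; split=> // -[fE|fE].
    by apply: nSe; rewrite -fE.
  by apply: nSe; rewrite -(erevK e) -fE; exact: sS.
exists f; split=> //; split.
- by apply: sym_setU => //; exact: sym_pair.
- have DU := @linkedS _ D (D `|` [set f; erev f]) _ _ (@subsetUl _ _ _).
  have sU : symmetric_edges (D `|` [set f; erev f]).
    by apply: sym_setU => //; exact: sym_pair.
  have ee : linked (D `|` [set f; erev f]) (src e) (tgt e).
    have /(linkedS (B := D `|` [set e; erev e])) := cS' (src f) (tgt f).
    have S'D : S' `<=` D `|` [set e; erev e].
      by move=> g S'g; case: (pselect ([set e; erev e] g)); [right|left].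
    move=> /(_ S'D)/linkedU1[//|[_ ef']|[fe _]].
      apply: linked_trans (DU _ _ ef) _.
      apply: linked_trans (linked_sym sU (DU _ _ ef')).
      by apply: linked_edge; right; left.
    exact: linked_trans (DU _ _ ef) (DU _ _ fe).
  move=> x y; apply: linked_sub (cS' x y) => g S'g.
  case: (pselect ([set e; erev e] g)) => [[->//|->]|neg].
    by rewrite tgt_erev; exact: linked_sym.
  by apply: linked_edge; left.
- exact: acyclicU1.
Qed.

(** Once the complement of [S] is finite, so is the number [n] of edges of [S'] outside [S]. An
    exchange lowers [n] by one and preserves the number of edges outside [S']. *)
Lemma ecard_spanning_tree_compl S S' : spanning_tree S -> spanning_tree S' ->
  ecard (geometric_edges (~` S)) = ecard (geometric_edges (~` S')).
Proof.
wlog fS : S S' / finite_set (geometric_edges (~` S)) => [wlogfin|] tS tS'.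
  case: (pselect (finite_set (geometric_edges (~` S)))) => [fS|iS].
    exact: wlogfin.
  case: (pselect (finite_set (geometric_edges (~` S')))) => [fS'|iS'].
    exact/esym/wlogfin.
  by rewrite !ecard_inf.
have [sS _ _] := tS.
have [n nE] : exists n, ecard (geometric_edges (~` S `&` S')) = n%:E.
  rewrite ecard_fin; first by eexists.
  by apply: sub_finite_set fS => _ [e [Se _] <-]; exists e.
elim: n => [|n IHn] in S' tS' nE *; have [sS' _ aS'] := tS'.
  rewrite (spanning_tree_subset tS tS')// => e S'e; apply: contrapT => nSe.
  move/eqP: nE; rewrite ecard_eq0 => /eqP/seteqP[+ _].
  by move=> /(_ [set e; erev e]); apply; exists e.
have sI : symmetric_edges (~` S `&` S').
  by apply: sym_setI => //; exact: sym_setC.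
have [e [nSe S'e]] : exists e, (~` S `&` S') e.
  apply: contrapT => nex; move: nE.
  suff -> : geometric_edges (~` S `&` S') = set0 by rewrite ecard0.
  by rewrite -subset0 => X [e eP _]; apply: nex; exists e.
have [f [Sf nS'f tS'']] := spanning_tree_exchange tS tS' S'e nSe.
have nSN : ~ S (erev e) by move=> /sS; rewrite erevK.
have S'N : S' (erev e) by exact: sS'.
have nS'N : ~ S' (erev f) by move=> /sS'; rewrite erevK.
have SN : S (erev f) by exact: sS.
rewrite (IHn _ tS''); last first.
  move: nE; rewrite (@ecard_geometric_edgesD1 _ _ e)//.
  have -> : ~` S `&` (S' `\` [set e; erev e] `|` [set f; erev f]) =
      (~` S `&` S') `\` [set e; erev e].
    apply/seteqP; split=> [g [nSg [[S'g ng]//|[gE|gE]]]|g [[nSg S'g] ng]].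
    - by case: nSg; rewrite gE.
    - by case: nSg; rewrite gE.
    - by split=> //; left.
  case: (ecard _) => // m [/eqP].
  by rewrite -[(_ + _)%R]/(_ + _)%N addn1 eqSS => /eqP ->.
have sC : symmetric_edges (~` (S' `\` [set e; erev e] `|` [set f; erev f])).
  by apply: sym_setC; have [] := tS''.
(* Without [f], the complement of [S'] equals the complement of the exchanged tree without [e]. *)
rewrite (@ecard_geometric_edgesD1 _ (~` S') f)//; last exact: sym_setC.
rewrite (@ecard_geometric_edgesD1 _ _ e)//; last first.
  by move=> [[_]|[eE|eE]]; [apply; left|move: S'e; rewrite eE..].
congr (ecard (geometric_edges _) + _)%E.
apply/seteqP; split=> g.
  move=> [ng neg]; split=> [S'g|fg]; apply: ng; [by left|by right].
move=> [nS'g nfg]; split=> [[[//]|//]|[gE|gE]]; by apply: nS'g; rewrite gE.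
Qed.

(* [x0] excludes the empty graph, whose [rank] is the junk value [+oo]. *)
Lemma rank_spanning_tree S (x0 : vertex G) :
  spanning_tree S -> rank G = ecard (geometric_edges (~` S)).
Proof.
move=> tS; have [sS cS aS] := tS.
have Gconn x y : linked setT x y := linkedS (@subsetT _ S) (cS x y).
apply: xget_unique; last first.
  move=> _ [M /(maximal_subtree_spanning Gconn)[_ tM] ->].
  exact: ecard_spanning_tree_compl.
pose M := Subgraph sS (fun _ _ => I : setT _); exists M => //.
split; first by apply/is_subtreeE; split=> //; exists x0.
(* An edge added to [S] would not be a bridge, since [S] already links its ends. *)
move=> S' /is_subtreeE[_ _ aS'] [_ /= SS']; split=> // e S'e.
apply: contrapT => nSe; apply: (aS' e S'e); apply: linkedS (cS _ _) => f Sf.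
split; first exact: SS'.
by case=> fE; apply: nSe; [rewrite -fE|rewrite -(erevK e) -fE; exact/sS].
Qed.

End Rank.

(** * Invariant subtrees *)

Section QuotientGraph.
Variables (H : groupType) (X : hgraph H) (L : groupClosed H).

Lemma vclassW (o : vertex (quot X L)) : exists x, o = vclass L x.
Proof.
exists (repr (o : {eq_quot (orbv_equiv X L)}%qT)).
by rewrite /vclass reprK.
Qed.

Lemma quot_src_eclass (e : edge X) :
  src (eclass L e : edge (quot X L)) = vclass L (src e).
Proof. exact: quot_srcE. Qed.

Lemma quot_erev_eclass (e : edge X) :
  erev (eclass L e : edge (quot X L)) = eclass L (erev e).
Proof. exact: quot_revE. Qed.

Lemma quot_tgt_eclass (e : edge X) :
  tgt (eclass L e : edge (quot X L)) = vclass L (tgt e).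
Proof. by rewrite /tgt quot_erev_eclass quot_src_eclass. Qed.

(** An invariant set of vertices descends to a set of orbits, so links in the quotient can be
    exploited upstairs without lifting walks. *)
Lemma linked_quot_invariant (A : set (edge (quot X L))) (P : set (vertex X)) :
    (forall x h, h \in L -> P x -> P (actv x h)) ->
    (forall e, A (eclass L e) -> P (src e) -> P (tgt e)) ->
  forall x y, linked A (vclass L x) (vclass L y) -> P x -> P y.
Proof.
move=> PL PA x y xy Px.
apply: (xy (fun o => forall z, o = vclass L z -> P z)) => //; last first.
  by move=> z /vclassP[h hL <-]; exact: PL.
move=> e'; have [e ->] := eclassW e'; rewrite quot_src_eclass quot_tgt_eclass.
move=> Ae Psrc z /vclassP[h hL <-]; apply: PL => //.
by apply: PA => //; exact: Psrc.
Qed.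

Lemma linked_quot (A : set (edge (quot X L))) (B : set (edge X)) x y :
  (forall e, B e -> linked A (vclass L (src e)) (vclass L (tgt e))) ->
  linked B x y -> linked A (vclass L x) (vclass L y).
Proof.
move=> BA xy; apply: (xy (fun z => linked A (vclass L x) (vclass L z))) => //.
by move=> e /BA ee xe; exact: linked_trans ee.
Qed.

End QuotientGraph.

(** * Distance and retraction to an invariant subtree *)

Section InvariantSubtree.
Variables (H : groupType) (T : hgraph H) (L : groupClosed H) (K : subgraph T).
Hypothesis treeT : is_tree T.
Hypothesis freeT : trivial_edge_stabilisers T.
Hypothesis K_neq0 : sverts K !=set0.
Hypothesis K_linked :
  forall x y, sverts K x -> sverts K y -> linked (sedges K) x y.
Hypothesis KvL : forall x h, h \in L -> sverts K x -> sverts K (actv x h).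

Lemma tgt_acte (e : edge T) h : tgt (acte e h) = actv (tgt e) h.
Proof. by rewrite /tgt erev_acte src_acte. Qed.

Let linkedT x y : linked [set: edge T] x y.
Proof. by have /is_subtreeE[_ cT _] := treeT; exact: cT. Qed.

Let acyclicT : acyclic [set: edge T].
Proof. by have /is_subtreeE[] := treeT. Qed.

(** A walk of exactly [n] edges leads from [x] into [K]; the least such [n], named [depth] below, is
    the distance to [K]. *)
Fixpoint within (n : nat) (x : vertex T) : Prop :=
  if n is n'.+1 then exists2 e, src e = x & within n' (tgt e) else sverts K x.

Lemma within_ex x : exists n, `[< within n x >].
Proof.
have [k Kk] := K_neq0; suff [n nx] : exists n, within n x.
  by exists n; apply/asboolP.
apply: (@linkedT k x (fun z => exists n, within n z)); last by exists 0.
by move=> e _ [n ne]; exists n.+1, (erev e) => //; rewrite tgt_erev.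
Qed.

Definition depth x := ex_minn (within_ex x).

Lemma within_depth x : within (depth x) x.
Proof. by rewrite /depth; case: ex_minnP => n /asboolP. Qed.

Lemma depth_min n x : within n x -> depth x <= n.
Proof. by rewrite /depth; case: ex_minnP => m _ min /asboolP/min. Qed.

Lemma within_act n x h : h \in L -> within n x -> within n (actv x h).
Proof.
move=> hL; elim: n x => [|n IHn] x /=; first exact: KvL.
move=> [e <- /IHn ne]; exists (acte e h); first by rewrite src_acte.
by rewrite tgt_acte.
Qed.

Lemma depth_act x h : h \in L -> depth (actv x h) = depth x.
Proof.
move=> hL; apply/eqP; rewrite eqn_leq; apply/andP; split; apply: depth_min.
  exact/within_act/within_depth.
have : within (depth (actv x h)) (actv (actv x h) h^-1).
  by apply: within_act (within_depth _); rewrite gpredV.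
by rewrite actvK.
Qed.

Lemma depth_subtree x : sverts K x -> depth x = 0.
Proof. by move=> Kx; apply/eqP; rewrite -leqn0; exact: (@depth_min 0). Qed.

Definition towards (e : edge T) := depth (src e) = (depth (tgt e)).+1.

Lemma towards_act e h : h \in L -> towards e -> towards (acte e h).
Proof. by move=> hL; rewrite /towards src_acte tgt_acte !depth_act. Qed.

Lemma towards_ex x : ~ sverts K x -> exists2 e, src e = x & towards e.
Proof.
move=> nKx; have := within_depth x; case dx : (depth x) => [|n] //= [e ex ne].
exists e => //; rewrite /towards ex; apply/eqP; rewrite eqn_leq; apply/andP.
split; last by rewrite dx ltnS; exact: depth_min.
by apply: depth_min; exists e => //; exact: within_depth.
Qed.

Lemma towards_src e : towards e -> ~ sverts K (src e).
Proof. by rewrite /towards => de /depth_subtree; rewrite de. Qed.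

Lemma towards_erev e : towards e -> ~ towards (erev e).
Proof.
rewrite /towards tgt_erev => -> /eqP; rewrite -/(tgt e).
by rewrite -addn2 -{1}[depth _]addn0 eqn_add2l.
Qed.

(* [K] and one chosen edge towards [K] at each vertex already connect [T], so
   every other edge would close a cycle. *)
Lemma towards_choice : exists o : vertex T -> option (edge T),
  (forall x e, o x = Some e -> src e = x /\ towards e) /\
  forall e, [\/ sedges K e, o (src e) = Some e | o (tgt e) = Some (erev e)].
Proof.
have /choice[o oP] : forall x, exists c : option (edge T),
    if c is Some e then src e = x /\ towards e else sverts K x.
  move=> x; case: (pselect (sverts K x)) => [Kx|/towards_ex[e ex te]].
    by exists None.
  by exists (Some e).
have oSome x e : o x = Some e -> src e = x /\ towards e.
  by move=> oxE; have := oP x; rewrite oxE.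
exists o; split=> // f.
pose S : set (edge T) := [set e |
  [\/ sedges K e, o (src e) = Some e | o (tgt e) = Some (erev e)]].
have sS : symmetric_edges S.
  move=> e [Ke|oe|oe]; first by apply: Or31; exact: sedges_erev.
    by apply: Or33; rewrite tgt_erev erevK.
  exact: Or32.
have [k Kk] := K_neq0.
have Sk x : linked S x k.
  have [n] := ubnP (depth x); elim: n => // n IHn in x *; rewrite ltnS => xn.
  case oxE : (o x) => [e|]; last first.
    have := oP x; rewrite oxE => Kx; apply: linkedS (K_linked Kx Kk) => e Ke.
    exact: Or31.
  have [ex te] := oSome _ _ oxE; apply: (@linked_trans _ _ (tgt e)).
    by rewrite -ex; apply: linked_edge; apply: Or32; rewrite ex.
  by apply: IHn; apply: leq_trans xn; rewrite -ex te.
apply: contrapT => nSf; apply: (acyclicT (e := f)) => //.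
apply: (@linkedS _ S); last first.
  exact: linked_trans (Sk _) (linked_sym sS (Sk _)).
move=> e Se; split=> // -[eE|eE]; apply: nSf; first by rewrite -eE.
by rewrite -(erevK f) -eE; exact: sS.
Qed.

(** An edge towards [K] starts outside [K], and its reverse is not towards [K]; the trichotomy of
    [towards_choice] leaves only the edge chosen at its source. *)
Lemma towards_unique e f : towards e -> towards f -> src e = src f -> e = f.
Proof.
have [o [oP oT]] := towards_choice.
suff oE g : towards g -> o (src g) = Some g.
  by move=> /oE oe /oE of_ ef; move: oe; rewrite ef of_ => -[].
move=> tg; have [/sedges_src/(towards_src tg)//|//|/oP[_]] := oT g.
by move/(towards_erev tg).
Qed.

Lemma towards_or e : ~ sedges K e -> towards e \/ towards (erev e).
Proof.
move=> nKe; have [o [oP oT]] := towards_choice.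
by have [//|/oP[_]|/oP[_]] := oT e; [left|right].
Qed.

(** By uniqueness, [h] fixes the edge from [x] towards [K], and edge stabilisers are trivial. *)
Lemma stab_outside x h : ~ sverts K x -> h \in L -> actv x h = x -> h = 1%g.
Proof.
move=> /towards_ex[e <- te] hL eh; apply: (freeT (e := e)).
by apply: towards_unique => //; [exact: towards_act|rewrite src_acte].
Qed.

(** The default value [x] makes [up] fix the vertices of [K], from which no edge goes towards
    [K]. *)
Definition up x := xget x [set tgt e | e in [set e | src e = x /\ towards e]].

Lemma up_towards e : towards e -> up (src e) = tgt e.
Proof.
move=> te; apply: xget_unique; first by exists e.
by move=> _ [f [fe tf] <-]; congr tgt; exact: towards_unique.
Qed.

Lemma up_subtree x : sverts K x -> up x = x.
Proof.
move=> Kx; apply: xgetPN => y [e [ex /towards_src nKe] _].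
by apply: nKe; rewrite ex.
Qed.

Lemma up_act x h : h \in L -> up (actv x h) = actv (up x) h.
Proof.
move=> hL; case: (pselect (sverts K x)) => [Kx|/towards_ex[e <- te]].
  by rewrite !up_subtree//; exact: KvL.
by rewrite -src_acte !up_towards ?tgt_acte//; exact: towards_act.
Qed.

Lemma depth_up x : depth (up x) = (depth x).-1.
Proof.
case: (pselect (sverts K x)) => [Kx|/towards_ex[e <- te]].
  by rewrite up_subtree// depth_subtree.
by rewrite up_towards// te.
Qed.

(** Iterate [up] as many times as the depth. Both are compatible with [L], and each edge outside [K]
    is, in one orientation, a single step of [up]. *)
Lemma retraction : exists rho : vertex T -> vertex T,
  [/\ forall x, sverts K (rho x), forall x, sverts K x -> rho x = x,
      forall x h, h \in L -> rho (actv x h) = actv (rho x) h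
    & forall e, ~ sedges K e -> rho (src e) = rho (tgt e)].
Proof.
pose rho x := iter (depth x) up x.
have rhoK x : sverts K x -> rho x = x by rewrite /rho => /depth_subtree ->.
have rho_towards e : towards e -> rho (src e) = rho (tgt e).
  by move=> te; rewrite /rho te iterSr up_towards.
exists rho; split=> // [x|x h hL|e /towards_or[/rho_towards//|]].
- have [n] := ubnP (depth x); elim: n => // n IHn in x *; rewrite ltnS => xn.
  case: (pselect (sverts K x)) => [Kx|/towards_ex[e ex te]].
    by rewrite rhoK.
  rewrite -ex rho_towards//; apply: IHn; apply: leq_trans xn.
  by rewrite -ex te.
- rewrite /rho depth_act//; elim: (depth x) => //= n ->; exact: up_act.
- by move=> /rho_towards; rewrite tgt_erev.
Qed.

Lemma outside_bridge (e : edge T) (c := eclass L e : edge (quot T L)) :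
  ~ sedges K e -> ~ linked (~` [set c; erev c]) (src c) (tgt c).
Proof.
wlog te : e @c / towards e => [wlogt nKe|_].
  case: (towards_or nKe) => te; first exact: wlogt.
  have nKe' : ~ sedges K (erev e) by move=> /sedges_erev; rewrite erevK.
  have := wlogt _ te nKe'; rewrite -quot_erev_eclass erevK tgt_erev setUC.
  move=> nee ee; apply: nee; apply: linked_sym => //.
  exact/sym_setC/sym_pair.
rewrite /c quot_src_eclass quot_tgt_eclass => ee.
(* These are the vertices whose path to [K] meets a translate of [src e]. The set can be left only
   along the orbit of [e], and [tgt e] is not in it, having smaller depth than [src e]. *)
pose P x := exists2 n, True & exists2 h, h \in L & iter n up x = actv (src e) h.
have [] : P (tgt e).
- apply: (linked_quot_invariant (P := P) _ _ ee).
  + move=> x h hL [n _ [g gL xE]]; exists n => //; exists (g * h)%g.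
      by rewrite gpredM.
    by rewrite actvM -xE; elim: (n) => //= m ->; rewrite up_act.
  + move=> f nf [n _ [h hL fE]]; case: (pselect (sedges K f)) => [Kf|].
      case: (towards_src (towards_act hL te)).
      rewrite src_acte -fE; suff -> : iter n up (src f) = src f.
        exact: sedges_src.
      by elim: (n) => //= m ->; exact/up_subtree/sedges_src.
    case/towards_or => tf; last first.
      exists n.+1 => //; exists h => //.
      by rewrite iterSr -fE (up_towards tf) tgt_erev.
    case: n => [|n] in fE *; last first.
      by exists n => //; exists h => //; rewrite -fE iterSr up_towards.
    (* With [n = 0] the source of [f] is a translate of [src e], so by uniqueness [f] is a translate
       of [e], which was excluded. *)
    case: nf; left; apply/esym/eclassP; exists h => //.
    by apply: towards_unique; rewrite ?src_acte//; exact: towards_act.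
  + by exists 0 => //; exists 1%g; rewrite ?gpred1 ?actv1.
- move=> n _ [h hL /(congr1 depth)]; rewrite depth_act// te => dE.
  have : depth (iter n up (tgt e)) <= depth (tgt e).
    elim: (n) => //= m IHm; rewrite depth_up; apply: leq_trans IHm.
    exact: leq_pred.
  by rewrite dE ltnn.
Qed.

End InvariantSubtree.

(** * Counting along the collapse *)

Section Coarsen.
Variables (H : groupType) (X : hgraph H) (L : groupClosed H).

(** The projection from [X / L] to [X / H]; [coarsevE] shows that it does not depend on the
    representative. *)
Definition coarsev (o : vertex (quot X L)) : vertex (quot X (whole H)) :=
  vclass (whole H) (repr (o : {eq_quot (orbv_equiv X L)}%qT)).

Definition coarsee (o : edge (quot X L)) : edge (quot X (whole H)) :=
  eclass (whole H) (repr (o : {eq_quot (orbe_equiv X L)}%qT)).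

Lemma coarsevE x : coarsev (vclass L x) = vclass (whole H) x.
Proof.
apply/vclassP; set y := repr _.
have /vclassP[h _ <-] : vclass L y = vclass L x by rewrite /vclass reprK.
by exists h.
Qed.

Lemma coarseeE e : coarsee (eclass L e) = eclass (whole H) e.
Proof.
apply/eclassP; set f := repr _.
have /eclassP[h _ <-] : eclass L f = eclass L e by rewrite /eclass reprK.
by exists h.
Qed.

Lemma coarsee_erev (o : edge (quot X L)) : coarsee (erev o) = erev (coarsee o).
Proof.
have [e ->] := eclassW o.
by rewrite quot_erev_eclass !coarseeE quot_erev_eclass.
Qed.

End Coarsen.

(** * Components of the subforest and their stabilisers *)

Section Main.
Variables (H : groupType) (T : hgraph H).
Hypothesis treeT : is_tree T.
Hypothesis freeT : trivial_edge_stabilisers T.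
Variables (F : subgraph T) (F_inv : invariant_subgraph F).
Variable r :
  vertex (quot (collapse F_inv) (whole H)) -> vertex (collapse F_inv).
Hypothesis rK : cancel r (vclass (whole H)).

Let X := collapse F_inv.
Let G := quot T (whole H).
Let GX := quot X (whole H).
Implicit Types (o : vertex GX) (x y : vertex T) (e f : edge T) (h : H).

Let vc x : vertex G := vclass (whole H) x.
Let ec e : edge G := eclass (whole H) e.

Let L o : groupClosed H := stab (r o).

Let vXP := @vclassP H X (whole H).
Let eXP := @eclassP H X (whole H).

Lemma component_tgt e : sedges F e -> component F (tgt e) = component F (src e).
Proof.
move=> Fe; apply/esym/componentP; exists [:: e].
by split=> // f; rewrite inE => /eqP ->.
Qed.

Lemma component_act x h :
  component F (actv x h) = actv (component F x : vertex X) h.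
Proof. by rewrite /= collapse_actvE. Qed.

Lemma mem_L o h : (h \in L o) = (actv (r o) h == r o).
Proof. by rewrite unfold_in. Qed.

Lemma component_subtree_src o e :
  [set f | sedges F f /\ component F (src f) = r o] e ->
  [set x | component F x = r o] (src e).
Proof. by case. Qed.

Lemma component_subtree_erev o e :
  [set f | sedges F f /\ component F (src f) = r o] e ->
  [set f | sedges F f /\ component F (src f) = r o] (erev e).
Proof.
by move=> [Fe eo]; split; [exact: sedges_erev|rewrite -eo -(component_tgt Fe)].
Qed.

(** The part of [T] collapsed to [r o]; it is a single vertex when no edge of [F] lies in it. *)
Definition comp_subtree o : subgraph T :=
  Subgraph (@component_subtree_erev o) (@component_subtree_src o).

Lemma comp_neq0 o : sverts (comp_subtree o) !=set0.
Proof. by have [x xE] := componentW (r o); exists x. Qed.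

Lemma comp_linked o x y :
  sverts (comp_subtree o) x -> sverts (comp_subtree o) y ->
  linked (sedges (comp_subtree o)) x y.
Proof.
move=> /= xo yo; have /componentP[p xpy] : component F x = component F y.
  by rewrite xo.
have /linkedP xy : exists p, walk_on (sedges F) x p y by exists p.
suff [] : component F y = r o /\ linked (sedges (comp_subtree o)) x y by [].
apply: (xy (fun z =>
  component F z = r o /\ linked (sedges (comp_subtree o)) x z)) => //.
move=> e Fe [eo xe]; rewrite component_tgt//; split=> //.
by apply: linked_trans xe _; exact: linked_edge.
Qed.

Lemma comp_act o x h :
  h \in L o -> sverts (comp_subtree o) x -> sverts (comp_subtree o) (actv x h).
Proof. by rewrite mem_L => /eqP hL /= xo; rewrite component_act xo. Qed.

(** Hence vertices of the component in one [H]-orbit are in one [L o]-orbit: the component modulo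
    [L o] embeds in [T / H]. *)
Lemma comp_act_mem o x h :
  sverts (comp_subtree o) x -> sverts (comp_subtree o) (actv x h) -> h \in L o.
Proof. by move=> /= xo; rewrite component_act xo mem_L => ->. Qed.

Lemma comp_acte o e h :
  h \in L o -> sedges (comp_subtree o) (acte e h) <-> sedges (comp_subtree o) e.
Proof.
have imp f g :
    g \in L o -> sedges (comp_subtree o) f ->
    sedges (comp_subtree o) (acte f g).
  move=> gL [Ff fo]; split; first exact: F_inv.2.
  by rewrite src_acte; exact: (@comp_act o).
move=> hL; split=> [|/imp]; last exact.
by move=> /(imp _ h^-1%g); rewrite gpredV acteK; exact.
Qed.

Lemma comp_edge_act_mem o e h :
  sedges (comp_subtree o) e -> sedges (comp_subtree o) (acte e h) -> h \in L o.
Proof. by move=> [_ eo] [_]; rewrite src_acte; exact: comp_act_mem. Qed.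

(** Together with [comp_cover], this says that the images in [T / H] of the chosen components
    partition its vertices. *)
Lemma comp_uniq o o' x h :
  sverts (comp_subtree o) x -> sverts (comp_subtree o') (actv x h) -> o = o'.
Proof.
move=> /= xo; rewrite component_act xo => rE.
by rewrite -(rK o) -(rK o'); apply/vXP; exists h.
Qed.

Lemma comp_cover x : exists o h, sverts (comp_subtree o) (actv x h).
Proof.
pose o : vertex GX := vclass (whole H) (component F x : vertex X).
have /vXP[h _ hE] : vclass (whole H) (component F x : vertex X) =
  vclass (whole H) (r o) by rewrite rK.
by exists o, h; rewrite /= component_act.
Qed.

Definition quotF : set (edge G) := [set e' | exists2 e, sedges F e & e' = ec e].

Lemma quotFE e : quotF (ec e) <-> sedges F e.
Proof.
split=> [[f Ff /esym/eclassP[h _ <-]]|]; first exact: F_inv.2.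
by exists e.
Qed.

Lemma sym_quotF : symmetric_edges quotF.
Proof.
move=> _ [e Fe ->]; exists (erev e); first exact: sedges_erev.
by rewrite quot_erev_eclass.
Qed.

Lemma linkedT x y : linked [set: edge T] x y.
Proof. by have /is_subtreeE[_ cT _] := treeT; exact: cT. Qed.

(** A spanning forest of [F / H] is built first and then extended to all of [T / H]. *)
Lemma adapted_spanning_tree : exists S : set (edge G),
  spanning_tree S /\
  forall e, sedges F e -> linked (S `&` quotF) (vc (src e)) (vc (tgt e)).
Proof.
have [||||S1 [sS1 aS1 _ S1F cS1]] := @maximal_acyclic G set0 quotF.
- by [].
- exact: sym_quotF.
- by [].
- exact: sub0set.
have [||||S [sS aS S1S _ cS]] := @maximal_acyclic G S1 setT => //.
exists S; split.
  split=> // o1 o2; have [x ->] := vclassW o1; have [y ->] := vclassW o2.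
  apply: linked_quot (@linkedT x y) => e _.
  by have := cS (ec e) I; rewrite quot_src_eclass quot_tgt_eclass.
move=> e /quotFE/cS1; rewrite quot_src_eclass quot_tgt_eclass.
by apply: linkedS => f S1f; split; [exact: S1S|exact: S1F].
Qed.

(** * Induced spanning trees and the count *)

Section Adapted.
Variable S : set (edge G).
Hypothesis treeS : spanning_tree S.
Hypothesis linkedF :
  forall e, sedges F e -> linked (S `&` quotF) (vc (src e)) (vc (tgt e)).

Let sS : symmetric_edges S. Proof. by case: treeS. Qed.

Definition collapse_tree : set (edge GX) :=
  [set e' | exists2 e : edge X, S (ec (val e)) & e' = eclass (whole H) e].

Lemma collapse_treeE (e : edge X) :
  collapse_tree (eclass (whole H) e) <-> S (ec (val e)).
Proof.
split=> [[f Sf /esym/eXP[h _ <-]]|Se]; last by exists e.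
suff -> : ec (val (acte f h)) = ec (val f) by [].
by apply/esym/eclassP; exists h.
Qed.

(** Links in [S] project to the collapse, where edges of [F] become trivial. Conversely a link in
    the collapse lifts to [S] by inserting links in [F / H] within components; these avoid the
    removed edge, which is outside [F]. *)
Lemma spanning_collapse_tree : spanning_tree collapse_tree.
Proof.
have [_ cS aS] := treeS; split.
- move=> _ [e Se ->]; exists (erev e); last by rewrite quot_erev_eclass.
  by rewrite /ec /= -quot_erev_eclass; exact: sS.
- pose vX x : vertex GX := vclass (whole H) (component F x : vertex X).
  suff cX x y : linked collapse_tree (vX x) (vX y).
    move=> o1 o2; have [c1 ->] := vclassW o1; have [c2 ->] := vclassW o2.
    by have [x ->] := componentW c1; have [y ->] := componentW c2; exact: cX.
  apply: (linked_quot_invariant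
    (P := fun z => linked collapse_tree (vX x) (vX z)) _ _
    (cS (vc x) (vc y))) => //.
    move=> z h _ xz; suff -> : vX (actv z h) = vX z by [].
    by apply/esym/vXP; exists h; rewrite // component_act.
  move=> e Se xe; case: (pselect (sedges F e)) => [Fe|nFe].
    by rewrite /vX component_tgt.
  pose e' : edge X := exist _ e (introT (asboolP _) nFe).
  apply: linked_trans xe _.
  have := linked_edge (A := collapse_tree) (e := eclass (whole H) e').
  by rewrite quot_src_eclass quot_tgt_eclass; apply; apply/collapse_treeE.
- move=> _ [e Se ->]; rewrite quot_src_eclass quot_tgt_eclass.
  set D := _ `\` _ => ee; apply: (aS _ Se).
  set D' := _ `\` _; pose P (c : vertex X) := forall z, component F z = c ->
    linked D' (vc (src (val e))) (vc z).
  have nFe : ~ sedges F (val e) by case: (e) => f fF; apply/asboolP.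
  have FD' z z' : component F z = component F z' -> linked D' (vc z) (vc z').
    move=> /componentP[p zpz'].
    have /linkedP zz' : exists p, walk_on (sedges F) z p z' by exists p.
    apply: linked_quot zz' => f /linkedF; apply: linkedS => g [Sg SFg].
    split=> // -[gE|gE].
      by apply: nFe; apply/quotFE; rewrite -/(ec _) -gE.
    by apply: nFe; apply/quotFE; rewrite -[ec _]erevK -gE; exact: sym_quotF.
  rewrite quot_src_eclass quot_tgt_eclass.
  apply: (linked_quot_invariant (P := P) _ _ ee) => //;
    last by move=> z /esym/FD'.
    move=> c h _ Pc z zE.
    suff <- : vc (actv z h^-1%g) = vc z.
      by apply: Pc; rewrite component_act zE actvK.
    by apply/esym/vclassP; exists h^-1%g.
  move=> f Df Pf z zE.
  apply: (@linked_trans _ _ (vc (tgt (val f)))); last first.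
    by apply: FD'; rewrite zE.
  apply: linked_trans (Pf (src (val f)) _) _ => //.
  have := linked_edge (A := D') (e := ec (val f)).
  rewrite quot_src_eclass quot_tgt_eclass; apply.
  have [/collapse_treeE Sf nf] := Df; split=> // -[/eclassP[h _ hE]|].
    apply: nf; left; apply/eXP; exists h => //; exact: val_inj.
  rewrite quot_erev_eclass => /eclassP[h _ hE]; apply: nf; right.
  by rewrite quot_erev_eclass; apply/eXP; exists h => //; exact: val_inj.
Qed.

Definition comp_tree o : set (edge (quot T (L o))) :=
  [set e' | exists2 e, S (ec e) \/ ~ sedges (comp_subtree o) e
                     & e' = eclass (L o) e].
Arguments comp_tree : clear implicits.

Lemma ec_act e h : ec (acte e h) = ec e.
Proof. by apply/esym/eclassP; exists h. Qed.

Lemma vc_act x h : vc (actv x h) = vc x.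
Proof. by apply/esym/vclassP; exists h. Qed.

Lemma comp_treeE o e :
  comp_tree o (eclass (L o) e) <-> S (ec e) \/ ~ sedges (comp_subtree o) e.
Proof.
split=> [[f fS /esym/eclassP[h hL <-]]|]; last by exists e.
by rewrite ec_act comp_acte.
Qed.

(** Connectedness: links of [S] over [F] lift inside the component. Acyclicity: edges outside it are
    bridges by [outside_bridge], and the retraction turns a link that bypasses an inside edge into a
    link of [S] that bypasses its image. *)
Lemma spanning_comp_tree o : spanning_tree (comp_tree o).
Proof.
have [_ cS aS] := treeS.
have [rho [rhoK rho_id rho_act rho_edge]] :=
  retraction treeT (comp_neq0 o) (@comp_linked o) (@comp_act o).
have sSin : symmetric_edges (comp_tree o).
  move=> _ [e eS ->]; exists (erev e); last by rewrite quot_erev_eclass.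
  case: eS => [Se|nKe]; [left|right].
    by rewrite /ec -quot_erev_eclass; exact: sS.
  by move=> /sedges_erev; rewrite erevK.
split=> //.
- have cK x y : sverts (comp_subtree o) x -> sverts (comp_subtree o) y ->
      linked (comp_tree o) (vclass (L o) x) (vclass (L o) y).
    move=> Kx Ky.
    have xy : linked (S `&` quotF) (vc x) (vc y).
      by apply: linked_quot (comp_linked Kx Ky) => e [Fe _]; exact: linkedF.
    (* A link in [T / H] determines vertices only up to [H], so every translate falling in the
       component is considered. *)
    pose P z := forall h, sverts (comp_subtree o) (actv z h) ->
      linked (comp_tree o) (vclass (L o) x) (vclass (L o) (actv z h)).
    have Py : P y; last by have := Py 1%g; rewrite actv1; exact.
    apply: (linked_quot_invariant (P := P) _ _ xy).
    + by move=> z h _ Pz g; rewrite -actvM; exact: Pz.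
    + move=> e [Se /quotFE Fe] Pe h Keh.
      have Feh : sedges F (acte e h) by exact: F_inv.2.
      apply: (@linked_trans (quot T (L o)) _ (vclass (L o) (actv (src e) h))).
        apply: Pe; rewrite -src_acte /= -component_tgt// tgt_acte.
        exact: Keh.
      rewrite -src_acte -tgt_acte.
      have := linked_edge (A := comp_tree o) (e := eclass (L o) (acte e h)).
      rewrite quot_src_eclass quot_tgt_eclass; apply; apply/comp_treeE.
      by left; rewrite ec_act.
    + move=> h Kxh; suff -> : vclass (L o) (actv x h) = vclass (L o) x by [].
      by apply/esym/vclassP; exists h => //; exact: comp_act_mem Kx Kxh.
  suff [k Kk ck] : exists2 k, sverts (comp_subtree o) k &
      forall x, linked (comp_tree o) (vclass (L o) k) (vclass (L o) x).
    move=> o1 o2; have [x ->] := vclassW o1; have [y ->] := vclassW o2.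
    by apply: linked_trans (ck y); exact: linked_sym.
  have [k Kk] := comp_neq0 o; exists k => // x.
  apply: linked_quot (@linkedT k x) => e _.
  case: (pselect (sedges (comp_subtree o) e)) => [Ke|nKe].
    by apply: cK; apply: sedges_src => //; exact: sedges_erev.
  have := linked_edge (A := comp_tree o) (e := eclass (L o) e).
  by rewrite quot_src_eclass quot_tgt_eclass; apply; apply/comp_treeE; right.
- move=> _ [e eS ->].
  case: (pselect (sedges (comp_subtree o) e)) => [Ke|nKe]; last first.
    move=> ee; apply: (outside_bridge treeT (comp_neq0 o) (@comp_linked o)
      (@comp_act o) nKe).
    by apply: linkedS ee => f [].
  case: eS => // Se; rewrite quot_src_eclass quot_tgt_eclass => ee.
  have := aS _ Se; set D' := _ `\` _; rewrite quot_src_eclass quot_tgt_eclass.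
  apply; pose P x := linked D' (vc (src e)) (vc (rho x)).
  suff : P (tgt e).
    by rewrite /P rho_id//; apply: sedges_src; exact: sedges_erev.
  apply: (linked_quot_invariant (P := P) _ _ ee).
  + by move=> x h hL; rewrite /P rho_act// vc_act.
  + move=> f [/comp_treeE Sf nf] Pf.
    case: (pselect (sedges (comp_subtree o) f)) => [Kf|nKf].
      case: Sf => // Sf; apply: linked_trans Pf _.
      rewrite !rho_id; [|exact: sedges_src (sedges_erev Kf)|exact: sedges_src].
      have := linked_edge (A := D') (e := ec f).
      rewrite quot_src_eclass quot_tgt_eclass; apply; split=> // fE.
      (* An element of [H] carrying one edge of the component to another lies in [L o], so [f] would
         be in the removed [L o]-orbit. *)
      apply: nf; case: fE => [/eclassP[h _ hE]|].
        left; apply/eclassP; exists h => //; apply: (comp_edge_act_mem Kf).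
        by rewrite hE.
      rewrite !quot_erev_eclass => /eclassP[h _ hE].
      right; apply/eclassP; exists h => //; apply: (comp_edge_act_mem Kf).
      by rewrite hE; exact: sedges_erev.
    by rewrite /P -rho_edge.
  + by rewrite /P rho_id//; exact: sedges_src.
Qed.

(** The embedding of the edges of the collapsed quotient in [T / H], as the edges outside
    [F / H]. *)
Definition outer_edge (e' : edge GX) : edge G :=
  ec (val (repr (e' : {eq_quot (orbe_equiv X (whole H))}%qT))).

Lemma outer_edgeE (e : edge X) : outer_edge (eclass (whole H) e) = ec (val e).
Proof.
rewrite /outer_edge; set f := repr _.
have /eXP[h _ <-] : eclass (whole H) f = eclass (whole H) e.
  by rewrite /eclass reprK.
by rewrite ec_act.
Qed.

Lemma complement_decomposition :
  ~` S = (\bigcup_o (@coarsee H T (L o) @` (~` comp_tree o)))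
         `|` outer_edge @` (~` collapse_tree).
Proof.
apply/seteqP; split=> [e'|e' [[o _ [c nSc <-]]|[c nSc <-]]].
- have [e ->] := eclassW e' => nSe.
  case: (pselect (sedges F e)) => [Fe|nFe].
    have [o [h Kh]] := comp_cover (src e).
    left; exists o => //; exists (eclass (L o) (acte e h)); last first.
      by rewrite coarseeE; exact: ec_act.
    move=> /comp_treeE; rewrite ec_act => -[//|]; apply.
    split; first exact: F_inv.2.
    by rewrite src_acte.
  pose f : edge X := exist _ e (introT (asboolP _) nFe).
  right; exists (eclass (whole H) f); last by rewrite outer_edgeE.
  by move=> /collapse_treeE.
- have [e cE] := eclassW c; move: nSc; rewrite cE coarseeE => nSe Se.
  by apply: nSe; apply/comp_treeE; left.
- have [e cE] := eclassW c; move: nSc; rewrite cE outer_edgeE => nSe Se.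
  by apply: nSe; apply/collapse_treeE.
Qed.

Lemma stab_in_comp o x h :
  h \in L o -> h != 1%g -> actv x h = x -> sverts (comp_subtree o) x.
Proof.
move=> hL /eqP h1 xh; apply: contrapT => nKx; apply: h1.
exact: (stab_outside treeT freeT (comp_neq0 o) (@comp_linked o)
  (@comp_act o) nKx hL xh).
Qed.

Definition stab_orbits (M : groupClosed H) : set (vertex (quot T M)) :=
  [set c | exists v : vertex T,
    c = vclass M v /\ exists h, [/\ h \in M, h != 1%g & actv v h = v]].
Arguments stab_orbits : clear implicits.

Let stab_part o : set (vertex G) := @coarsev H T (L o) @` stab_orbits (L o).
Let cotree_part o : set (edge G) := @coarsee H T (L o) @` (~` comp_tree o).

(** Vertices with nontrivial stabiliser in [L o] lie in the component, where passing from
    [L o]-orbits to [H]-orbits is injective. *)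
Lemma ecard_stab_part o : ecard (stab_part o) = kurosh_c T (L o).
Proof.
apply: ecard_image => c d /set_mem[x [-> [h [hL h1 xh]]]].
move=> /set_mem[y [-> [g [gL g1 yg]]]]; rewrite !coarsevE.
move=> /vclassP[k _ xk]; apply/vclassP; exists k => //.
by apply: (@comp_act_mem o x); [|rewrite xk];
  [exact: stab_in_comp xh|exact: stab_in_comp yg].
Qed.

Lemma trivIset_stab_part : trivIset setT stab_part.
Proof.
move=> o o' _ _ [c [[_ [x [-> [h [hL h1 xh]]]] <-]]].
move=> [d [y [-> [g [gL g1 yg]]]]]; rewrite !coarsevE => /esym/vclassP[k _ xk].
by apply: (@comp_uniq o o' x k); [|rewrite xk];
  [exact: stab_in_comp xh|exact: stab_in_comp yg].
Qed.

Lemma bigcup_stab_part : \bigcup_o stab_part o = stab_orbits (whole H).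
Proof.
apply/seteqP; split=> [_ [o _ [_ [x [-> [h [_ h1 xh]]]] <-]]|].
  by exists x; rewrite coarsevE; split=> //; exists h.
move=> _ [x [-> [h [_ h1 xh]]]]; have [o [k Kxk]] := comp_cover x.
(* After [k] moves [x] into a chosen component, the conjugate of [h] fixes a vertex there and
   therefore lies in [L o]. *)
have xkE : actv (actv x k) (k^-1 * h * k)%g = actv x k.
  by rewrite -actvM !mulgA mulgV mul1g actvM xh.
exists o => //; exists (vclass (L o) (actv x k)); last first.
  by rewrite coarsevE; exact: vc_act.
exists (actv x k); split=> //; exists (k^-1 * h * k)%g; split=> //.
  by apply: (@comp_act_mem o (actv x k)); rewrite ?xkE.
apply: contra h1 => /eqP kh1; apply/eqP/(@mulgI _ k^-1%g)/(@mulIg _ k).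
by rewrite kh1 mulg1 mulVg.
Qed.

Lemma comp_tree_compl o (c : edge (quot T (L o))) : ~ comp_tree o c ->
  exists e, [/\ c = eclass (L o) e, ~ S (ec e) & sedges (comp_subtree o) e].
Proof.
have [e ->] := eclassW c => nS; exists e; split=> //.
  by move=> Se; apply: nS; apply/comp_treeE; left.
by apply: contrapT => nKe; apply: nS; apply/comp_treeE; right.
Qed.

(** Edges of [T / L o] outside the spanning tree come from the component, so distinct ones stay
    distinct in [T / H]. *)
Lemma ecard_cotree_part o :
  ecard (geometric_edges (cotree_part o)) = rank (quot T (L o)).
Proof.
have tS := spanning_comp_tree o; have [sSin _ _] := tS.
have [x _] := comp_neq0 o.
rewrite (@rank_spanning_tree (quot T (L o)) _ (vclass (L o) x) tS).
rewrite ecard_geometric_edges_image//.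
- exact: sym_setC.
- by move=> *; exact: coarsee_erev.
move=> c d /set_mem/comp_tree_compl[e [-> _ Ke]].
move=> /set_mem/comp_tree_compl[f [-> _ Kf]].
rewrite !coarseeE => /eclassP[h _ ef]; apply/eclassP; exists h => //.
by apply: (comp_edge_act_mem Ke); rewrite ef.
Qed.

Lemma sym_cotree_part o : symmetric_edges (cotree_part o).
Proof.
move=> _ [c nSc <-]; exists (erev c); last exact: coarsee_erev.
by apply: sym_setC nSc; case: (spanning_comp_tree o).
Qed.

Lemma trivIset_cotree_part :
  trivIset setT (fun o => geometric_edges (cotree_part o)).
Proof.
move=> o o' _ _ [D [[c Bc <-] [d Bd dE]]].
have : [set d; erev d] c by rewrite dE; left.
move=> cd; have {cd d Bd dE} B'c : cotree_part o' c.
  by case: cd => ->//; exact: sym_cotree_part.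
have [d /comp_tree_compl[e [-> _ Ke]]] := Bc; rewrite coarseeE => eE.
have [d' /comp_tree_compl[f [-> _ Kf]]] := B'c; rewrite coarseeE => fE.
have /eclassP[h _ ef] : ec e = ec f by rewrite /ec eE.
apply: (@comp_uniq o o' (src e) h); first exact: sedges_src.
by rewrite -src_acte ef; exact: sedges_src.
Qed.

Lemma ecard_outer :
  ecard (geometric_edges (outer_edge @` (~` collapse_tree))) = rank GX.
Proof.
have [sSout _ _] := spanning_collapse_tree.
have [_ [o _]] : exists x : vertex T, exists o : vertex GX, True.
  have [[x _] _ _] := treeT; exists x.
  by exists (vclass (whole H) (component F x : vertex X)).
rewrite (rank_spanning_tree o spanning_collapse_tree).
rewrite ecard_geometric_edges_image//.
- exact: sym_setC.
- move=> c _; have [e ->] := eclassW c.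
  by rewrite quot_erev_eclass !outer_edgeE quot_erev_eclass.
move=> c d _ _; have [e ->] := eclassW c; have [f ->] := eclassW d.
rewrite !outer_edgeE => /eclassP[h _ ef].
by apply/eXP; exists h => //; exact: val_inj.
Qed.

Lemma rank_quot_decomposition :
  rank G = (ecard (\bigcup_o geometric_edges (cotree_part o)) + rank GX)%E.
Proof.
have [[x _] _ _] := treeT; rewrite (rank_spanning_tree (vc x) treeS).
rewrite -ecard_outer complement_decomposition ecard_geometric_edgesU.
- by rewrite /geometric_edges image_bigcup.
- move=> _ [c nSc <-]; exists (erev c).
    by apply: sym_setC nSc; case: spanning_collapse_tree.
  have [e ->] := eclassW c.
  by rewrite quot_erev_eclass !outer_edgeE quot_erev_eclass.
(* The two parts are disjoint: the first lies in [F / H], the second outside it. *)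
rewrite -subset0 => _ [[o _ [c /comp_tree_compl[e [-> _ [Fe _]]] <-]]] [d _].
have [f ->] := eclassW d; rewrite coarseeE outer_edgeE => fe.
have nFf : ~ sedges F (val f) by case: (f) => g gF; apply/asboolP.
by apply: nFf; apply/quotFE; rewrite fe; apply/quotFE.
Qed.

(** Both summands of each [kappa T (L o)] are realised by families of disjoint sets in [T / H], so
    [nsum_ecardD] turns the sum into the cardinals of two unions. *)
Lemma kappa_decomposition :
  kappa T (whole H) = (nsum (fun o => kappa T (L o)) + rank GX)%E.
Proof.
rewrite /kappa rank_quot_decomposition addrA.
under [in RHS]eq_fun do rewrite -ecard_stab_part -ecard_cotree_part.
rewrite (nsum_ecardD trivIset_stab_part trivIset_cotree_part).
by rewrite bigcup_stab_part.
Qed.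

End Adapted.

End Main.

Theorem theorem2p4 (H : groupType) (T : hgraph H) (treeT : is_tree T)
    (freeT : trivial_edge_stabilisers T)
    (F : subgraph T) (F_inv : invariant_subgraph F)
    (r : vertex (quot (collapse F_inv) (whole H)) -> vertex (collapse F_inv))
    (rK : cancel r (vclass (whole H))) :
  kappa T (whole H) =
    (nsum (fun o => kappa T (stab (r o)))
     + rank (quot (collapse F_inv) (whole H)))%E
  /\ (kappa T (whole H) = +oo%E <->
      (nsum (fun o => kappa T (stab (r o)))
       + rank (quot (collapse F_inv) (whole H)))%E = +oo%E).
Proof.
have [S [treeS linkedF]] := adapted_spanning_tree treeT F_inv.
by rewrite (kappa_decomposition treeT freeT rK treeS linkedF).
Qed.
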